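(* Let $\Omega\subset\mathbb{R}^N$ be a bounded, connected, open set with Lipschitz boundary, let $\Psi\colon\Omega\times\mathbb{R}^{d\times N}\to[0,+\infty)$ be continuous, let $r>0$ and let $\alpha_r(x)=r^{-N}\alpha(x/r)$, where $\alpha\in C_c^\infty(\mathbb{R}^N)$, $\operatorname{spt}\alpha\subset B_1$ and $\int_{B_1}\alpha\,dx=1$. For $u\in SBV(\Omega;\mathbb{R}^d)$ set $$E^{\alpha_r}(u):=\int_{\Omega_r}\Psi\bigg(x,\int_{B_r(x)\cap S_u}\alpha_r(x-y)\,[u](y)\otimes\nu_u(y)\,d\mathcal H^{N-1}(y)\bigg)dx .$$ Then for every $(g,G)\in SBV(\Omega;\mathbb{R}^d)\times L^1(\Omega;\mathbb{R}^{d\times N})$ and for every admissible sequence $(u_n)\in\mathsf{Ad}(g,G)$, $$\lim_{n\to\infty}E^{\alpha_r}(u_n)=\int_{\Omega_r}\Psi\bigg(x,\int_{B_r(x)}\alpha_r(x-y)(\nabla g-G)(y)\,dy+\int_{B_r(x)\cap S_g}\alpha_r(x-y)\,[g](y)\otimes\nu_g(y)\,d\mathcal H^{N-1}(y)\bigg)dx .$$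
   Context: $B_r(x)$ is the open ball of radius $r$ centred at $x$, $B_1=B_1(0)$, and $\Omega_r:=\{x\in\Omega:\operatorname{dist}(x,\partial\Omega)>r\}$. For $u\in SBV(\Omega;\mathbb{R}^d)$ the distributional derivative is $Du=\nabla u\,\mathcal L^N+D^su$ with $D^su=[u]\otimes\nu_u\,\mathcal H^{N-1}\llcorner S_u$, where $\nabla u$ is the density of the absolutely continuous part, $S_u$ is the jump set, $[u]=u^+-u^-$ is the jump and $\nu_u$ the unit normal to $S_u$. Thus the inner integral in $E^{\alpha_r}(u)$ is the convolution $(D^su*\alpha_r)(x)=\int_\Omega\alpha_r(x-y)\,dD^su(y)$. For $(g,G)\in SBV(\Omega;\mathbb{R}^d)\times L^1(\Omega;\mathbb{R}^{d\times N})$, $\mathsf{Ad}(g,G)$ is the set of sequences $(u_n)\subset SBV(\Omega;\mathbb{R}^d)$ such that, as $n\to\infty$: $u_n\to g$ in $L^1(\Omega;\mathbb{R}^d)$; $\nabla u_n\,\mathcal L^N$ converges weakly-* to $G\,\mathcal L^N$ in $\mathcal M(\Omega;\mathbb{R}^{d\times N})$; and $D^su_n$ converges weakly-* to $(\nabla g-G)\mathcal L^N+D^sg$ in $\mathcal M(\Omega;\mathbb{R}^{d\times N})$. Here $\mathcal M(\Omega;\mathbb{R}^{d\times N})$ is the space of finite matrix-valued Radon measures on the open set $\Omega$, and weak-* convergence is tested against $C_0(\Omega)$ functions (closure of $C_c(\Omega)$ in the sup norm). *)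

(* Defs.v *)
From HB Require Import structures.
From mathcomp Require Import all_boot all_order all_algebra.
From mathcomp Require Import all_classical all_reals all_analysis.

Set Implicit Arguments.
Unset Strict Implicit.
Unset Printing Implicit Defensive.

Import Order.TTheory GRing.Theory Num.Theory.
Import numFieldNormedType.Exports.

Local Open Scope classical_set_scope.
Local Open Scope ring_scope.

Section cover_outer_measure.
Local Open Scope ereal_scope.
Context (R : realType) (T I : Type) (S : I -> set T) (w : I -> \bar R).

Definition cover_outer (X : set T) : \bar R :=
  ereal_inf [set \sum_(k <oo) w (J k) |
    J in [set J : nat -> I | X `<=` \bigcup_k S (J k)]].

Hypothesis w_ge0 : forall i, 0 <= w i.

Lemma le_cover_outer : {homo cover_outer : A B / A `<=` B >-> A <= B}.
Proof.
move=> A B AB; apply/ereal_inf_le_tmp => x [J BJ <-{x}].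
by exists J => //; apply: subset_trans AB BJ.
Qed.

Lemma cover_outer_ge0 A : 0 <= cover_outer A.
Proof. by apply: le_ereal_inf_tmp => x [J AJ <-{x}]; exact: nneseries_ge0. Qed.

Lemma cover_outer0 : (exists i, w i = 0) -> cover_outer set0 = 0.
Proof.
move=> [i wi0]; apply/eqP; rewrite eq_le cover_outer_ge0 andbT.
apply: ereal_inf_lbound; exists (fun=> i) => //.
by rewrite eseries0.
Qed.

Lemma cover_outer_sigma_subadditive : sigma_subadditive cover_outer.
Proof.
move=> A; have [[i ioo]|] := pselect (exists i, cover_outer (A i) = +oo).
  rewrite (eseries_pinfty _ _ ioo) ?leey// => n _.
  by rewrite -ltNye (lt_le_trans _ (cover_outer_ge0 _)).
rewrite -forallNE => Aoo.
apply/lee_addgt0Pr => e' e'0; pose e : {posnum R} := PosNum e'0.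
rewrite -[e']/(e%:num)%R (le_trans _ (epsilon_trick _ _ _))//; last first.
  by move=> n; exact: cover_outer_ge0.
pose P n (J : nat -> I) := A n `<=` \bigcup_k S (J k) /\
  \sum_(k <oo) w (J k) <= cover_outer (A n) + (e%:num / (2 ^ n.+1)%:R)%:E.
have [G PG] : {G : nat -> nat -> I & forall n, P n (G n)}.
  apply: (@choice _ _ P) => n; rewrite /P /cover_outer.
  set Z := (X in ereal_inf X); move infZ : (ereal_inf Z) => iZ.
  case: iZ infZ => [r Zr|Zoo|Zoo].
  - have en1 : (0 < e%:num / (2 ^ n.+1)%:R)%R by [].
    have /(lb_ereal_inf_adherent en1) : ereal_inf Z \is a fin_num by rewrite Zr.
    move=> [x [J AJ wJx] xZ].
    by exists J; split => //; rewrite wJx -Zr; exact/ltW.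
  - by have := Aoo n; rewrite /cover_outer Zoo.
  - suff : lbound Z 0 by move/le_ereal_inf_tmp; rewrite Zoo.
    by move=> /= _ [J AJ <-]; exact: nneseries_ge0.
have wG_ge0 x : 0 <= (w \o uncurry G) x by exact: w_ge0.
apply: (@le_trans _ _ (\esum_(i in setT) (w \o uncurry G) i)).
  apply: ereal_inf_lbound => /=.
  have /card_esym/ppcard_eqP[f] := card_nat2.
  exists (uncurry G \o f).
    move=> t [i _ /(PG i).1[j _ Gijt]].
    by exists (f^-1%FUN (i, j)) => //=; rewrite invK ?inE.
  rewrite -(esum_pred_image (w \o uncurry G) _ xpredT) ?[fun=> _]set_true//.
  by rewrite image_eq.
rewrite (_ : esum _ _ = \sum_(i <oo) \sum_(j <oo ) w (G i j)); last first.
  pose J : nat -> set (nat * nat) := fun i => [set (i, j) | j in setT].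
  rewrite (_ : setT = \bigcup_k J k); last first.
    by rewrite predeqE => -[a b]; split => // _; exists a => //; exists b.
  rewrite esum_bigcupT /=; last 2 first.
    - apply/trivIsetP => i j _ _ ij.
      rewrite predeqE => -[n m] /=; split => //= -[] [_] _ [<-{n} _].
      by move=> [m' _] [] /esym/eqP; rewrite (negbTE ij).
    - by move=> /= [n m]; exact: w_ge0.
  rewrite -(image_id [set: nat]) -fun_true esum_pred_image//; last first.
    by move=> n _; exact: esum_ge0.
  apply: eq_eseriesr => /= j _.
  rewrite -(esum_pred_image (w \o uncurry G) (pair j) predT)//=; last first.
    by move=> ? ? _ _; exact: (@can_inj _ _ _ snd).
  by congr esum; rewrite predeqE => -[a b]; split; move=> [i _ <-]; exists i.
apply: lee_lim.
- by apply: is_cvg_nneseries => n *; apply: nneseries_ge0 => m *; exact: w_ge0.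
- by apply: is_cvg_nneseries => n *; apply: adde_ge0 => //; exact: cover_outer_ge0.
- by near=> n; apply: lee_sum => i _; exact: (PG i).2.
Unshelve. all: by end_near. Qed.

End cover_outer_measure.

(* The topology of ['M[R]_(m, k)] is the library's (sup norm); lengths,
   distances, balls and diameters are Euclidean (Frobenius on matrices). *)
Section euclidean.
Context (R : realType).

Definition enorm m k (A : 'M[R]_(m, k)) : R :=
  Num.sqrt (\sum_i \sum_j A i j ^+ 2).

Definition edot k (x y : 'rV[R]_k) : R := \sum_i x 0 i * y 0 i.

Definition eball k (x : 'rV[R]_k) (r : R) : set 'rV[R]_k :=
  [set y | enorm (y - x) < r].

Definition half_ball k (x nu : 'rV[R]_k) (r : R) : set 'rV[R]_k :=
  [set y | eball x r y /\ 0 < edot (y - x) nu].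

Definition boundary k (A : set 'rV[R]_k) : set 'rV[R]_k :=
  closure A `\` interior A.

Definition edist k (x : 'rV[R]_k) (A : set 'rV[R]_k) : R :=
  inf [set enorm (x - y) | y in A].

Definition ediam k (A : set 'rV[R]_k) : \bar R :=
  ereal_sup (0%E |` [set (enorm (x - y))%:E | x in A & y in A]).

(* Omega_r *)
Definition inner_set k (Omega : set 'rV[R]_k) (r : R) : set 'rV[R]_k :=
  [set x | Omega x /\ r < edist x (boundary Omega)].

End euclidean.

(* Lebesgue measure on R^(n+1): Caratheodory's construction from the volume of
   half-open boxes.  Dimension 0 is excluded because it has no empty box. *)
Section lebesgue.
Context (R : realType) (n : nat).

Definition box (ab : 'rV[R]_n.+1 * 'rV[R]_n.+1) : set 'rV[R]_n.+1 :=
  [set x | forall i, ab.1 0 i < x 0 i <= ab.2 0 i].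

Definition box_volume (ab : 'rV[R]_n.+1 * 'rV[R]_n.+1) : \bar R :=
  (\prod_i Num.max 0 (ab.2 0 i - ab.1 0 i))%:E.

Definition leb_outer : set 'rV[R]_n.+1 -> \bar R := cover_outer box box_volume.

Lemma box_volume_ge0 ab : (0 <= box_volume ab)%E.
Proof. by rewrite lee_fin; apply: prodr_ge0 => i _; rewrite le_max lexx. Qed.

Lemma box_volume_eq0 : exists ab, box_volume ab = 0%E.
Proof.
exists (0, 0); rewrite /box_volume big_ord_recl subrr maxxx mul0r.
by [].
Qed.

HB.instance Definition _ := isOuterMeasure.Build R 'rV[R]_n.+1 leb_outer
  (@cover_outer0 _ _ _ box _ box_volume_ge0 box_volume_eq0)
  (@cover_outer_ge0 _ _ _ box _ box_volume_ge0)
  (@le_cover_outer _ _ _ box box_volume)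
  (@cover_outer_sigma_subadditive _ _ _ box _ box_volume_ge0).

Let outer : {outer_measure set 'rV[R]_n.+1 -> \bar R} := leb_outer.

Definition leb : {measure set (caratheodory_type outer) -> \bar R} := outer.

End lebesgue.
Arguments leb {R n}.

(* Volume of the unit ball of R^s. *)
Definition unit_ball_volume (R : realType) (s : nat) : R :=
  if s is k.+1 then fine (@leb R k (eball 0 1)) else 1.

(* s-dimensional Hausdorff measure, with the normalization that makes it agree
   with s-dimensional Lebesgue measure on R^s. *)
Section hausdorff.
Context (R : realType) (n s : nat).
Local Open Scope ereal_scope.

(* The empty set is singled out because [0 ^+ 0 = 1]. *)
Definition hausdorff_weight (delta : R) (A : set 'rV[R]_n) : \bar R :=
  if A == set0 then 0 else
  if ediam A <= delta%:E then
    (unit_ball_volume R s * (fine (ediam A) / 2) ^+ s)%:E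
  else +oo.

Definition hausdorff_pre (delta : R) : set 'rV[R]_n -> \bar R :=
  cover_outer id (hausdorff_weight delta).

Definition hausdorff_outer (A : set 'rV[R]_n) : \bar R :=
  ereal_sup [set hausdorff_pre delta A | delta in [set x : R | (0 < x)%R]].

Lemma hausdorff_weight_ge0 delta A : 0 <= hausdorff_weight delta A.
Proof.
rewrite /hausdorff_weight; case: ifP => // _; case: ifP => // _.
rewrite lee_fin mulr_ge0//.
  by case: s => [|k]; rewrite ?ler01// fine_ge0.
rewrite exprn_ge0// divr_ge0// fine_ge0//.
by apply: ereal_sup_ubound; left.
Qed.

Lemma hausdorff_weight_eq0 delta : exists A, hausdorff_weight delta A = 0.
Proof. by exists set0; rewrite /hausdorff_weight eqxx. Qed.

Lemma hausdorff_outer0 : hausdorff_outer set0 = 0.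
Proof.
apply/eqP; rewrite eq_le; apply/andP; split.
  apply: ge_ereal_sup => _ [d _ <-].
  by rewrite /hausdorff_pre cover_outer0//;
    [exact: hausdorff_weight_ge0|exact: hausdorff_weight_eq0].
apply: ereal_sup_ubound; exists 1%R => //=.
by rewrite /hausdorff_pre cover_outer0//;
  [exact: hausdorff_weight_ge0|exact: hausdorff_weight_eq0].
Qed.

Lemma hausdorff_outer_ge0 A : 0 <= hausdorff_outer A.
Proof.
apply: (@le_trans _ _ (hausdorff_pre 1 A)).
  exact/cover_outer_ge0/hausdorff_weight_ge0.
by apply: ereal_sup_ubound; exists 1%R => //=.
Qed.

Lemma le_hausdorff_outer : {homo hausdorff_outer : A B / A `<=` B >-> A <= B}.
Proof.
move=> A B AB; apply: ge_ereal_sup => _ [d d0 <-].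
apply: (@le_trans _ _ (hausdorff_pre d B)).
  exact: le_cover_outer.
by apply: ereal_sup_ubound; exists d.
Qed.

Lemma hausdorff_outer_sigma_subadditive : sigma_subadditive hausdorff_outer.
Proof.
move=> F; apply: ge_ereal_sup => _ [d d0 <-].
apply: (le_trans (@cover_outer_sigma_subadditive _ _ _ id _ (hausdorff_weight_ge0 d) F)).
apply: lee_nneseries => [i _ _|i _].
  exact/cover_outer_ge0/hausdorff_weight_ge0.
by apply: ereal_sup_ubound; exists d.
Qed.

HB.instance Definition _ := isOuterMeasure.Build R 'rV[R]_n hausdorff_outer
  hausdorff_outer0 hausdorff_outer_ge0 le_hausdorff_outer
  hausdorff_outer_sigma_subadditive.

Let outer : {outer_measure set 'rV[R]_n -> \bar R} := hausdorff_outer.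

Definition hausdorff : {measure set (caratheodory_type outer) -> \bar R} :=
  outer.

End hausdorff.
Arguments hausdorff {R n} s.

Section domains_and_test_functions.
Context (R : realType) (n : nat).
Local Notation V := 'rV[R]_n.+1.

(* Near each boundary point, and up to an isometry [x |-> (x - x0) *m Q], the set
   is the strict epigraph of a Lipschitz function of the first n coordinates. *)
Definition lipschitz_boundary (Omega : set V) : Prop :=
  forall x0, boundary Omega x0 ->
  exists (Q : 'M[R]_n.+1) (gamma : 'rV[R]_n -> R) (rho : R),
    [/\ Q *m Q^T = 1%:M, lipschitz (gamma : 'rV[R]_n -> R^o), 0 < rho &
      forall x, eball x0 rho x ->
        let z := (x - x0) *m Q in
        Omega x <->
          gamma (\row_(i < n) z 0 (widen_ord (leqnSn n) i)) < z 0 ord_max].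

Definition e_ (j : 'I_n.+1) : V := delta_mx 0 j.

Fixpoint Ck (k : nat) (f : V -> R) : Prop :=
  if k is l.+1 then
    continuous f /\
    forall j, (forall x : V, derivable f x (e_ j)) /\ Ck l ('D_(e_ j) f)
  else continuous f.

Definition Csmooth (f : V -> R) : Prop := forall k, Ck k f.

Definition spt (f : V -> R) : set V := closure [set x | f x != 0].

Definition Cc (Omega : set V) (f : V -> R) : Prop :=
  [/\ continuous f, compact (spt f) & spt f `<=` Omega].

Definition Cc_smooth (Omega : set V) (f : V -> R) : Prop :=
  Csmooth f /\ Cc Omega f.

(* Only the values of [f] on [Omega] matter. *)
Definition C0 (Omega : set V) (f : V -> R) : Prop :=
  forall eps : R, 0 < eps ->
  exists2 h, Cc Omega h & forall x, Omega x -> `|f x - h x| <= eps.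

Definition L1 (Omega : set V) (f : V -> R) : Prop :=
  leb.-integrable Omega (EFin \o f).

Definition L1mx m k (Omega : set V) (f : V -> 'M[R]_(m, k)) : Prop :=
  forall i j, L1 Omega (fun x => f x i j).

Definition rescale (alpha : V -> R) (r : R) : V -> R :=
  fun x => r ^- n.+1 * alpha (r^-1 *: x).

End domains_and_test_functions.

(* Below N = n.+1, so that H^(N-1) is [hausdorff n]; functions are defined on
   all of R^N but only their values on [Omega] are used. *)
Section SBV.
Context (R : realType) (n d : nat).
Local Notation V := 'rV[R]_n.+1.
Implicit Types (Omega : set V) (u : V -> 'cV[R]_d).

(* [(a, b, nu)] are one-sided approximate limits and normal of [u] at [x]. *)
Definition jump_triple u (x : V) : set ('cV[R]_d * 'cV[R]_d * V) :=
  [set t | let: (a, b, nu) := t in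
    [/\ a != b, enorm nu = 1,
      (fun rho : R => (leb (half_ball x nu rho))^-1 *
        \int[leb]_(y in half_ball x nu rho) (enorm (u y - a))%:E)%E
        @ 0^'+ --> 0%E &
      (fun rho : R => (leb (half_ball x (- nu) rho))^-1 *
        \int[leb]_(y in half_ball x (- nu) rho) (enorm (u y - b))%:E)%E
        @ 0^'+ --> 0%E]].

Definition jump_set Omega u : set V :=
  [set x | Omega x /\ jump_triple u x !=set0].

(* The triple is unique up to exchanging [a] and [b] and changing the sign of
   [nu], which leaves [jump_dyad] unchanged. *)
Definition jump_data u (x : V) := xget (0, 0, 0) (jump_triple u x).
Definition trace_plus u (x : V) : 'cV[R]_d := (jump_data u x).1.1.
Definition trace_minus u (x : V) : 'cV[R]_d := (jump_data u x).1.2.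
Definition jump_normal u (x : V) : V := (jump_data u x).2.
Definition jump u (x : V) : 'cV[R]_d := trace_plus u x - trace_minus u x.

Definition jump_dyad u (x : V) : 'M[R]_(d, n.+1) :=
  jump u x *m jump_normal u x.

(* A finite matrix-valued Radon measure on [Omega], represented by the integrals
   of the functions of [C0 Omega] (Riesz). *)
Definition mxmeasure := (V -> R) -> 'M[R]_(d, n.+1).

(* [F L^N] on [Omega] *)
Definition lebesgue_part Omega (F : V -> 'M[R]_(d, n.+1)) : mxmeasure :=
  fun phi => \matrix_(i, j) (\int[leb]_(x in Omega) (phi x * F x i j))%R.

(* [D^s u], that is, the jump part of [D u] *)
Definition Ds Omega u : mxmeasure :=
  fun phi => \matrix_(i, j)
    (\int[hausdorff n]_(x in jump_set Omega u) (phi x * jump_dyad u x i j))%R.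

Definition add_mxmeasure (mu mu' : mxmeasure) : mxmeasure :=
  fun phi => mu phi + mu' phi.

Definition weakstar_cvg Omega (mu_ : nat -> mxmeasure) (mu : mxmeasure) : Prop :=
  forall phi, C0 Omega phi -> mu_ k phi @[k --> \oo] --> mu phi.

Definition is_distributional_derivative Omega u (mu : mxmeasure) : Prop :=
  forall phi, Cc_smooth Omega phi -> forall i j,
    (\int[leb]_(x in Omega) (u x i 0 * 'D_(e_ R j) phi x))%R = - mu phi i j.

(* [D u = H L^N + D^s u].  The jump set is Lebesgue negligible, so [H] is the
   density of the absolutely continuous part of [D u]. *)
Definition is_approx_gradient Omega u (H : V -> 'M[R]_(d, n.+1)) : Prop :=
  L1mx Omega H /\
  is_distributional_derivative Omega u
    (add_mxmeasure (lebesgue_part Omega H) (Ds Omega u)).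

(* [u] is in [L^1] and [D u] is the finite measure
   [nabla u L^N + [u] (x) nu_u H^(N-1) restricted to S_u] (no Cantor part).
   The measurability of [S_u], automatic in theory, is recorded because
   [integrable] says nothing about measurability on a nonmeasurable domain. *)
Definition SBV Omega u : Prop :=
  [/\ L1mx Omega u,
    (@hausdorff_outer R n.+1 n).-caratheodory (jump_set Omega u),
    forall i j, (hausdorff n).-integrable (jump_set Omega u)
      (fun x => (jump_dyad u x i j)%:E) &
    exists H, is_approx_gradient Omega u H].

Definition nabla Omega u : V -> 'M[R]_(d, n.+1) :=
  xget (fun=> 0) [set H | is_approx_gradient Omega u H].

Definition L1_cvg Omega (u_ : nat -> V -> 'cV[R]_d) u : Prop :=
  (\int[leb]_(x in Omega) (enorm (u_ k x - u x))%:E)%E @[k --> \oo] --> 0%E.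

Definition Ad Omega (g : V -> 'cV[R]_d) (G : V -> 'M[R]_(d, n.+1)) :
    set (nat -> V -> 'cV[R]_d) :=
  [set u_ | [/\ forall k, SBV Omega (u_ k),
    L1_cvg Omega u_ g,
    weakstar_cvg Omega (fun k => lebesgue_part Omega (nabla Omega (u_ k)))
      (lebesgue_part Omega G) &
    weakstar_cvg Omega (fun k => Ds Omega (u_ k))
      (add_mxmeasure (lebesgue_part Omega (fun x => nabla Omega g x - G x))
        (Ds Omega g))]].

(* [\int_(B_r(x)) alpha_r(x - y) F(y) dy] *)
Definition bulk_average (alpha : V -> R) (r : R) (F : V -> 'M[R]_(d, n.+1))
    (x : V) : 'M[R]_(d, n.+1) :=
  \matrix_(i, j)
    (\int[leb]_(y in eball x r) (rescale alpha r (x - y) * F y i j))%R.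

(* [\int_(B_r(x) \cap S_u) alpha_r(x - y) [u](y) (x) nu_u(y) dH^(N-1)(y)] *)
Definition jump_average (alpha : V -> R) (r : R) Omega u (x : V) :
    'M[R]_(d, n.+1) :=
  \matrix_(i, j) (\int[hausdorff n]_(y in eball x r `&` jump_set Omega u)
    (rescale alpha r (x - y) * jump_dyad u y i j))%R.

Definition energy (Psi : V -> 'M[R]_(d, n.+1) -> R) (alpha : V -> R) (r : R)
    Omega u : \bar R :=
  (\int[leb]_(x in inner_set Omega r)
    (Psi x (jump_average alpha r Omega u x))%:E)%E.

End SBV.

(* Main.v *)
Require Import Defs.
From mathcomp Require Import all_boot all_order all_algebra.
From mathcomp Require Import all_classical all_reals all_analysis.
From mathcomp Require Import measurable_realfun.
From mathcomp Require Import zify ring lra.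

Set Implicit Arguments.
Unset Strict Implicit.
Unset Printing Implicit Defensive.

Import Order.TTheory GRing.Theory Num.Theory.
Import numFieldNormedType.Exports.

Local Open Scope classical_set_scope.
Local Open Scope ring_scope.

(* For x in Omega_r the kernel y |-> alpha_r(x - y) is a continuous function
   compactly supported in B_r(x), which lies in Omega, so the inner integral of
   the energy is D^s u_n tested against it, and weak-* convergence gives the
   pointwise convergence of the integrands.  By uniform boundedness (a gliding
   hump on C_c(Omega), whose uniform limits are in C_0(Omega)) the inner
   integrals are bounded uniformly in x and n, so that the arguments of Psi stay
   in a compact subset of Omega x R^(d x N), where Psi is bounded; dominated
   convergence concludes.  Testing a jump measure is linear, and the energy
   densities are measurable, because continuous functions are measurable for the
   Caratheodory sigma-algebras of the Lebesgue and Hausdorff outer measures. *)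

(** * Borel sets are Caratheodory measurable *)

(** A cover of [X] is cut member by member into a cover of [A] and a cover of [B] of no larger total
    weight. This reduces superadditivity of the outer measure to a statement about single covering
    sets. *)
Lemma cover_outer_split (R : realType) (T I : Type) (S : I -> set T)
    (w : I -> \bar R) (A B X : set T) :
    (forall i, 0 <= w i)%E -> A `|` B `<=` X ->
    (forall i, exists i1 i2, [/\ S i `&` A `<=` S i1, S i `&` B `<=` S i2 &
      (w i1 + w i2 <= w i)%E]) ->
  (cover_outer S w A + cover_outer S w B <= cover_outer S w X)%E.
Proof.
move=> w0 ABX split_i; apply: le_ereal_inf_tmp => _ [J XJ <-].
have [J1 hJ1] := choice (fun k => split_i (J k)).
have [J2 hJ2] := choice hJ1.
have cA : (cover_outer S w A <= \sum_(k <oo) w (J1 k))%E.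
  apply: ereal_inf_lbound; exists J1 => // x Ax.
  have [k _ JKx] := XJ x (ABX _ (or_introl Ax)).
  by exists k => //; have [+ _ _] := hJ2 k; apply.
have cB : (cover_outer S w B <= \sum_(k <oo) w (J2 k))%E.
  apply: ereal_inf_lbound; exists J2 => // x Bx.
  have [k _ JKx] := XJ x (ABX _ (or_intror Bx)).
  by exists k => //; have [_ + _] := hJ2 k; apply.
apply: (le_trans (leeD cA cB)).
rewrite -nneseriesD//.
apply: lee_nneseries => [k _ _|k _]; first by rewrite adde_ge0.
by have [] := hJ2 k.
Qed.

(** Caratheodory's criterion for metric outer measures, with separation measured by the values of
    [f] instead of a distance. The part of [X] above level [a] is approximated by [A k], which a gap
    in the values of [f] separates from the sublevel set; what is left out consists of thin annuli
    whose measures have a small tail. *)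
Lemma caratheodory_sublevel (R : realType) (T : Type)
    (mu : {outer_measure set T -> \bar R}) (f : T -> R) :
    (forall A B s t, s < t -> (forall x, A x -> f x <= s) ->
       (forall x, B x -> t <= f x) -> (mu A + mu B <= mu (A `|` B))%E) ->
  forall a, (mu : set T -> \bar R).-caratheodory [set x | f x <= a].
Proof.
move=> sep a; apply: le_caratheodory_measurable => X.
set E := [set x | f x <= a].
have [->|Xoo] := eqVneq (mu X) +oo%E; first by rewrite leey.
pose q (k : nat) : R := a + k.+1%:R^-1.
have q_lt k : q k.+1 < q k by rewrite ltrD2l ltf_pV2 ?posrE// ltr_nat.
have q_gt k : a < q k by rewrite ltrDl.
pose A k := X `&` [set x | q k < f x].
pose D k := X `&` [set x | q k.+1 < f x <= q k].
have mono (Y Z : set T) : Y `<=` Z -> (mu Y <= mu Z)%E by exact: le_outer_measure.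
(* Only neighbouring annuli [D j] fail to be separated, so the sum of their
   measures is at most [2 * mu X]: its tail absorbs [mu (X `\` E) - mu (A k)]. *)
have DA m : (\sum_(0 <= j < m) mu (D j.+1) <= mu (A m) + mu (A m.+1))%E.
  elim: m => [|m IH].
    by rewrite big_geq//; apply: adde_ge0; exact: outer_measure_ge0.
  rewrite big_nat_recr//= (le_trans (leeD2r _ IH))// addeAC [leRHS]addeC leeD2r//.
  rewrite addeC.
  apply: (le_trans (sep _ _ _ _ (q_lt m) _ _)); first by move=> x [_] /andP[].
    by move=> x [_] /ltW.
  apply: mono => x [[Xx /andP[h1 h2]]|[Xx h1]]; split => //=.
  by rewrite (lt_trans _ h1)// (lt_trans (q_lt _)).
have Dfin : (\sum_(0 <= j <oo) mu (D j.+1) < +oo)%E.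
  apply: (@le_lt_trans _ _ (mu X + mu X)%E); last first.
    by rewrite lte_add_pinfty ?ltey.
  apply: lime_le; first by apply: is_cvg_nneseries => *; exact: outer_measure_ge0.
  by apply: nearW => m; apply: (le_trans (DA m)); apply: leeD; apply: mono => x [].
have tail := @nneseries_tail_cvg R _ xpredT Dfin (fun _ _ => outer_measure_ge0 _ _).
apply/lee_addgt0Pr => e e0.
have [k tail_k] : exists k, (\sum_(k <= j <oo) mu (D j.+1) <= e%:E)%E.
  have := tail; move/fine_cvgP => [_ /cvgrPdist_lt /(_ e e0)].
  have := tail; move=> /fine_cvgP[fn _] h.
  have [N _ hN] := filterI fn h.
  exists N; have [/= f1] := hN N (leqnn N).
  rewrite sub0r normrN => f2; rewrite -(fineK f1) lee_fin ltW//.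
  exact: le_lt_trans (ler_norm _) f2.
have cov : X `&` ~` E `<=` A k.+1 `|` \bigcup_j D (j + k).+1.
  move=> x [Xx /= /negP]; rewrite -ltNge => afx.
  have [h|h] := ltP (q k.+1) (f x); first by left.
  right.
  (* The annulus containing [x] is found from the least [m] with [q m < f x]: minimality gives
     [f x <= q m.-1]. This [m] exceeds [k.+1] because [f x <= q k.+1]. *)
  have ex : exists m, q m < f x.
    have fa : 0 < f x - a by rewrite subr_gt0.
    have [m _ /(_ m (leqnn m)) /= hm] := near_infty_natSinv_lt (PosNum fa).
    by exists m; rewrite /q -ltrBrDl.
  have q_le i j : (i <= j)%N -> q j <= q i.
    by move=> ij; rewrite lerD2l lef_pV2 ?posrE// ler_nat.
  case: (ex_minnP ex) => -[|m] hm mmin.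
    by move: hm; rewrite ltNge (le_trans h)// q_le.
  have km : (k.+1 <= m)%N.
    rewrite leqNgt; apply/negP => mk; move: hm; rewrite ltNge (le_trans h)//.
    exact: q_le.
  exists (m - k.+1)%N => //; rewrite (_ : (m - k.+1 + k).+1 = m); last by lia.
  split => //=; rewrite hm/= leNgt; apply/negP => /mmin; lia.
have XEC : (mu (X `&` ~` E) <= mu (A k.+1) + e%:E)%E.
  apply: (le_trans (mono _ _ cov)); apply: (le_trans (outer_measureU2 _ _ _)).
  rewrite leeD2l// (le_trans _ tail_k)//.
  rewrite -(@nneseries_addn R (fun j => mu (D j.+1))); last first.
    by move=> j; exact: outer_measure_ge0.
  exact: outer_measure_sigma_subadditive.
apply: (le_trans (leeD2l (mu (X `&` E)) XEC)); rewrite addeA leeD2r//.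
apply: (le_trans (sep _ _ a (q k.+1) (q_gt k.+1) _ _)).
- by move=> x [].
- by move=> x [_] /ltW.
- by apply: mono => x [][].
Qed.

(** The one property through which the Lebesgue and the Hausdorff outer measures enter the
    measurability of open sets and of continuous functions. *)
Definition coordinate_halfspaces_measurable (R : realType) m
    (mu : set 'rV[R]_m -> \bar R) : Prop :=
  forall i a, mu.-caratheodory [set x : 'rV[R]_m | x 0 i <= a].

(** A hyperplane orthogonal to an axis cuts a half-open box into two half-open boxes that differ
    from it in one side only, and the two lengths add up. A box missed by one half-space leaves a
    degenerate box there, of volume 0. *)
Lemma leb_halfspaces (R : realType) n :
  coordinate_halfspaces_measurable (@leb_outer R n).
Proof.
move=> i a; apply: (@le_caratheodory_measurable _ _ (@leb_outer R n)) => X.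
apply: cover_outer_split; first exact: box_volume_ge0.
  by move=> x [] [].
move=> [l u].
exists (l, \row_j if j == i then Num.min (u 0 i) a else u 0 j).
exists (\row_j if j == i then Num.max (l 0 i) a else l 0 j, u); split => /=.
- move=> x [lxu [_ /= xa]] j; rewrite mxE; have /= /andP[h1 h2] := lxu j.
  by rewrite h1; case: eqP => [ji|_ //]; rewrite ji le_min xa -ji h2.
- move=> x [lxu [_ /= /negP]]; rewrite -ltNge => xa j; rewrite mxE.
  have /= /andP[h1 h2] := lxu j.
  by rewrite h2 andbT; case: eqP => [ji|_ //]; rewrite ji gt_max xa -ji h1.
rewrite -EFinD lee_fin (bigD1 i)//= [X in _ + X](bigD1 i)//= [leRHS](bigD1 i)//=.
rewrite !mxE eqxx.
set P := (X in _ * X + _); set P' := (X in _ + _ * X); set P0 := (X in _ <= _ * X).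
have -> : P = P0 by apply: eq_bigr => j /negbTE ji; rewrite mxE ji.
have -> : P' = P0 by apply: eq_bigr => j /negbTE ji; rewrite mxE ji.
rewrite -mulrDl ler_wpM2r//.
  by apply: prodr_ge0 => j _; rewrite le_max lexx.
rewrite !maxEle !minEle.
by repeat case: ifPn => //; rewrite -?ltNge => *; lra.
Qed.

Lemma enorm_ge0 (R : realType) m k (A : 'M[R]_(m, k)) : 0 <= enorm A.
Proof. exact: sqrtr_ge0. Qed.

Lemma coord_le_enorm (R : realType) m k (A : 'M[R]_(m, k)) i j :
  `|A i j| <= enorm A.
Proof.
rewrite -sqrtr_sqr ler_wsqrtr// (bigD1 i)//= (bigD1 j)//= -addrA lerDl addr_ge0//.
  by apply: sumr_ge0 => *; exact: sqr_ge0.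
by apply: sumr_ge0 => *; apply: sumr_ge0 => *; exact: sqr_ge0.
Qed.

Lemma coord_le_norm (R : realType) m k (A : 'M[R]_(m, k)) i j : `|A i j| <= `|A|.
Proof.
rewrite -[leRHS]/(mx_norm A) mx_normrE.
exact: (le_bigmax _ (fun p => `|A p.1 p.2|) (i, j)).
Qed.

(** A set of diameter at most [delta] cannot meet both [A] and [B], so it is handed over whole to
    one side and the other side gets [set0]. A nonempty set of larger diameter has infinite weight
    and may go to both. *)
Lemma hausdorff_pre_separated (R : realType) n s (delta : R)
    (A B : set 'rV[R]_n) :
    (forall x y, A x -> B y -> delta < enorm (x - y)) ->
  (hausdorff_pre s delta A + hausdorff_pre s delta B <=
   hausdorff_pre s delta (A `|` B))%E.
Proof.
move=> AB; apply: cover_outer_split => //; first exact: hausdorff_weight_ge0.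
have w0 : hausdorff_weight s delta (set0 : set 'rV[R]_n) = 0%E.
  by rewrite /hausdorff_weight eqxx.
move=> S; have [dS|dS] := boolP (ediam S <= delta%:E)%E; last first.
  have [->|S0] := eqVneq S set0.
    by exists set0, set0; split; [by move=> x []|by move=> x []|rewrite w0 adde0].
  exists S, S; split; [by move=> x []|by move=> x []|].
  by rewrite /hausdorff_weight (negbTE S0) (negbTE dS) leey.
have [[x [Sx Ax]]|SA] := pselect (S `&` A !=set0).
  exists S, set0; split; [by move=> y []| |by rewrite w0 adde0].
  move=> y [Sy By]; have := AB _ _ Ax By; rewrite ltNge => /negP; apply.
  rewrite -lee_fin (le_trans _ dS)//; apply: ereal_sup_ubound; right.
  by exists x => //; exists y.
exists set0, S; split; [|by move=> y []|by rewrite w0 add0e].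
by move=> x SAx; apply: SA; exists x.
Qed.

(** Sets whose [i]-th coordinates are separated by [v - u] are at distance at least [v - u], so the
    premeasures at smaller scales are superadditive on them; the supremum over scales then gives the
    hypothesis of the sublevel criterion. *)
Lemma hausdorff_halfspaces (R : realType) n s :
  coordinate_halfspaces_measurable (@hausdorff_outer R n s).
Proof.
move=> i a.
apply: (@caratheodory_sublevel _ _ (@hausdorff_outer R n s) (fun x => x 0 i)).
move=> A B u v uv Au Bv.
have pre_mono (d e : R) (X : set 'rV[R]_n) : 0 < d -> d <= e ->
    (hausdorff_pre s e X <= hausdorff_pre s d X)%E.
  move=> d0 de; apply: le_ereal_inf_tmp => _ [J XJ <-].
  apply: (@le_trans _ _ (\sum_(k <oo) hausdorff_weight s e (J k))%E).
    by apply: ereal_inf_lbound; exists J.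
  apply: lee_nneseries => [k _ _|k _]; first exact: hausdorff_weight_ge0.
  rewrite /hausdorff_weight; case: ifP => // _; case: ifP => h1; case: ifP => h2//.
    by rewrite leey.
  by move: h1; rewrite (le_trans h2)// lee_fin.
have H d e : 0 < d -> 0 < e ->
   (hausdorff_pre s d A + hausdorff_pre s e B <= hausdorff_outer s (A `|` B))%E.
  (* The scale [c] is at most [d] and [e], so both premeasures only increase, and it is strictly
     below the gap [v - u]. *)
  move=> d0 e0; pose c := Num.min (Num.min d e) ((v - u) / 2).
  have vu2 : 0 < (v - u) / 2 by rewrite divr_gt0// subr_gt0.
  have c0 : 0 < c by rewrite !lt_min d0 e0.
  apply: (@le_trans _ _ (hausdorff_pre s c (A `|` B))); last first.
    by apply: ereal_sup_ubound; exists c.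
  apply: (@le_trans _ _ (hausdorff_pre s c A + hausdorff_pre s c B)%E); last first.
    apply: hausdorff_pre_separated => x y Ax By; apply: (@lt_le_trans _ _ (v - u)).
      by rewrite (@le_lt_trans _ _ ((v - u) / 2))// ?ge_min ?lexx ?orbT//; lra.
    have /= := coord_le_enorm (x - y) 0 i; rewrite !mxE; apply: le_trans.
    by rewrite distrC (le_trans _ (ler_norm _))// lerB// ?Au ?Bv.
  by apply: leeD; apply: pre_mono => //; rewrite !ge_min lexx ?orbT.
rewrite -[leLHS]/(hausdorff_outer s A + hausdorff_outer s B)%E.
rewrite -[leRHS]/(hausdorff_outer s (A `|` B)).
have [->|] := eqVneq (hausdorff_outer s (A `|` B)) +oo%E; first by rewrite leey.
rewrite -ltey => ABoo.
have fin (X : set 'rV[R]_n) : X `<=` A `|` B -> hausdorff_outer s X \is a fin_num.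
  move=> XAB; rewrite ge0_fin_numE; last exact: hausdorff_outer_ge0.
  by apply: le_lt_trans ABoo; exact: le_hausdorff_outer.
(* The suprema over [d] and over [e] are taken one after the other, the other summand being moved
   across the inequality each time; this is where finiteness is needed. *)
rewrite -leeBrDr; last by apply: fin => ?; right.
apply: ge_ereal_sup => _ [d d0 <-].
rewrite leeBrDr; last by apply: fin => ?; right.
have dfin : hausdorff_pre s d A \is a fin_num.
  rewrite ge0_fin_numE; last by apply/cover_outer_ge0/hausdorff_weight_ge0.
  apply: (@le_lt_trans _ _ (hausdorff_outer s (A `|` B))) => //.
  apply: le_trans (H d d d0 d0); rewrite leeDl//.
  by apply/cover_outer_ge0/hausdorff_weight_ge0.
rewrite addeC -leeBrDr//.
by apply: ge_ereal_sup => _ [e e0 <-]; rewrite leeBrDr// addeC H.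
Qed.

(** An open set is the union of the half-open boxes with rational corners that it contains. These
    are countably many, and each is a finite intersection of half-spaces and complements of
    half-spaces. *)
Lemma open_caratheodory (R : realType) m
    (mu : {outer_measure set 'rV[R]_m -> \bar R}) :
    coordinate_halfspaces_measurable mu ->
  forall U : set 'rV[R]_m, open U -> (mu : set _ -> \bar R).-caratheodory U.
Proof.
move=> mu_half U oU.
pose B (p : 'rV[rat]_m * 'rV[rat]_m) : set 'rV[R]_m :=
  [set x | forall i, ratr (p.1 0 i) < x 0 i <= ratr (p.2 0 i)].
pose W p := if asbool (B p `<=` U) then B p else set0.
have mB p : (measurable : set (set (caratheodory_type mu))) (B p).
  have -> : B p = \bigcap_i
     ([set x | x 0 i <= ratr (p.2 0 i)] `&` ~` [set x | x 0 i <= ratr (p.1 0 i)]).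
    apply/seteqP; split => x /= h i.
      by move=> _; have /andP[h1 h2] := h i; split => //=; apply/negP; rewrite -ltNge.
    by have [//|h2 /negP] := h i; rewrite -ltNge h2 => ->.
  apply: (@fin_bigcap_measurable _ (caratheodory_type mu)) => // i _.
  apply: measurableI; first exact: mu_half.
  by apply: measurableC; exact: mu_half.
have -> : U = \bigcup_p W p.
  apply/seteqP; split => [x Ux|x [p _]]; last first.
    by rewrite /W; case: asboolP => // + Bx; exact.
  have /nbhs_ballP[e /= e0 eU] : nbhs x U by exact: open_nbhs_nbhs.
  have rat_near (a b : R) : a < b -> exists q : rat, a < ratr q < b.
    by move=> ab; have [q] := rat_in_itvoo ab; rewrite in_itv/= => ?; exists q.
  have /choice[l hl] : forall i, exists q : rat, x 0 i - e < ratr q < x 0 i.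
    by move=> i; apply: rat_near; rewrite gtrDl oppr_lt0.
  have /choice[u hu] : forall i, exists q : rat, x 0 i < ratr q < x 0 i + e.
    by move=> i; apply: rat_near; rewrite ltrDl.
  have Bx : B (\row_i l i, \row_i u i) x.
    by move=> i; rewrite !mxE; case/andP: (hl i) => _ ->; case/andP: (hu i) => /ltW ->.
  exists (\row_i l i, \row_i u i) => //; rewrite /W asboolT// => y By; apply: eU.
  split=> // i j; rewrite (ord1 i); have := By j; rewrite !mxE/=.
  have := hl j; have := hu j; rewrite /ball/= ltr_distlC.
  move=> /andP[_ ?] /andP[? _] /andP[? ?].
  by apply/andP; split; lra.
apply: (@countable_bigcupT_measurable _ (caratheodory_type mu)) => // p.
rewrite /W; case: ifP => _ //; exact: measurable0.
Qed.

Lemma continuous_caratheodory_measurable (R : realType) m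
    (mu : {outer_measure set 'rV[R]_m -> \bar R}) (U : set 'rV[R]_m)
    (f : 'rV[R]_m -> R) :
    coordinate_halfspaces_measurable mu -> open U -> {in U, continuous f} ->
  measurable_fun (U : set (caratheodory_type mu)) f.
Proof.
move=> mu_half oU cf; apply: (measurability _ (RGenOInfty.measurableE R)).
move=> _ [_ [a ->] <-]; apply: open_caratheodory => //.
rewrite openE => x [Ux /=]; rewrite in_itv/= andbT => afx.
apply: filterI; first exact: open_nbhs_nbhs.
have ya : nbhs (f x) [set y | a < y].
  by apply: open_nbhs_nbhs; split => //; exact: open_gt.
have near_x : \forall y \near x, a < f y := cf x (mem_set Ux) _ ya.
by apply: filterS near_x => y /= ay; rewrite in_itv/= ay.
Qed.

Lemma leb_bounded_lty (R : realType) n (A : set 'rV[R]_n.+1) :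
  bounded_set A -> (leb_outer A < +oo)%E.
Proof.
move=> [M [Mreal AM]].
(* A single cube covers [A], followed by empty boxes. The bound on [A] is available for constants
   above [M], such as [|M| + 1]; one more unit makes the lower inequality of the half-open cube
   strict. *)
pose J k : 'rV[R]_n.+1 * 'rV[R]_n.+1 := if k is 0%N then
  (const_mx (- (`|M| + 2)), const_mx (`|M| + 2)) else (0, 0).
apply: (@le_lt_trans _ _ (\sum_(k <oo) box_volume (J k))%E).
  apply: ereal_inf_lbound; exists J => // x Ax; exists 0%N => // i /=.
  rewrite !mxE; have := AM (`|M| + 1) _ x Ax.
  rewrite (le_lt_trans (ler_norm _)) ?ltrDl// => /(_ isT) xM.
  have xi : `|x 0 i| <= `|M| + 1.
    exact: le_trans (coord_le_norm _ _ _) xM.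
  by move: xi; rewrite ler_norml => /andP[? ?]; apply/andP; split; lra.
rewrite nneseries_recl//; last by move=> k _; exact: box_volume_ge0.
rewrite eseries_cond eseries0 ?adde0 ?ltry// => -[//|k] _ _.
by rewrite /J/= /box_volume big_ord_recl/= subrr maxxx mul0r.
Qed.

(** * Uniform boundedness *)

Definition uniform_limit (R : realType) (T : Type) (F : nat -> T -> R)
    (f : T -> R) : Prop :=
  forall e, 0 < e -> \forall j \near \oo, forall x, `|f x - F j x| <= e.

Section gliding_hump.
Context (R : realType) (T : Type) (X : set (T -> R)) (L : nat -> (T -> R) -> R).
Hypothesis X0 : X (fun=> 0).
Hypothesis XD : forall f g c, X f -> X g -> X (fun x => f x + c * g x).
Hypothesis L_linear : forall k f g c, X f -> X g ->
  L k (fun x => f x + c * g x) = L k f + c * L k g.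
Hypothesis L_bounded : forall k, exists K : R, forall f, X f ->
  (forall x, `|f x| <= 1) -> `|L k f| <= K.
Hypothesis L_uniform : forall k F f, (forall j, X (F j)) -> uniform_limit F f ->
  L k (F j) @[j --> \oo] --> L k f.

Let c (j : nat) : R := 3^-1 ^+ j.

Let c_gt0 j : 0 < c j. Proof. by rewrite exprn_gt0. Qed.

Let cS j : c j.+1 = c j / 3. Proof. by rewrite /c exprSr. Qed.

Let c_small (e : R) : 0 < e -> \forall j \near \oo, c j <= e.
Proof.
move=> e0.
have : c j @[j --> \oo] --> (0 : R).
  by apply: cvg_expr; rewrite ger0_norm ?invr_ge0// invf_lt1// ltr1n.
move/cvgrPdist_le => /(_ e e0); apply: filterS => j.
by rewrite sub0r normrN; apply: le_trans; exact: ler_norm.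
Qed.

(** The limit is written as an infimum: with [c j = 3^-j], the sequence [F m x + 3 / 2 * c m] is
    nonincreasing in [m], and [3 / 2 * c m] is the whole geometric tail from [m] on. *)
Let geometric_uniform_limit (F : nat -> T -> R) :
    (forall j x, `|F j.+1 x - F j x| <= c j) ->
  exists2 f, uniform_limit F f &
    forall j m x, (j <= m)%N -> `|F m x - F j x| <= 3 / 2 * c j.
Proof.
move=> FS.
have Fm j m x : (j <= m)%N -> `|F m x - F j x| <= 3 / 2 * (c j - c m).
  move=> /subnKC <-; elim: (m - j)%N => [|i IH].
    by rewrite addn0 !subrr normr0 mulr0.
  rewrite addnS (le_trans (ler_distD (F (j + i)%N x) _ _))//.
  by rewrite (le_trans (lerD (FS _ _) IH))// cS; have := c_gt0 (j + i); lra.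
pose S x := range (fun m => F m x + 3 / 2 * c m).
have lbS j x y : S x y -> F j x - 3 / 2 * c j <= y.
  move=> [m _ <-]; have := c_gt0 j; have := c_gt0 m.
  by case: (leqP j m) => [/(Fm _ _ x)|/ltnW/(Fm _ _ x)];
    rewrite ler_distl => /andP[] *; lra.
exists (fun x => inf (S x)).
  move=> e e0; have e1 : 0 < e / (3 / 2) by rewrite divr_gt0.
  apply: filterS (c_small e1) => j; rewrite ler_pdivlMr// mulrC => je x.
  apply: (le_trans _ je); rewrite ler_distl; apply/andP; split.
    by apply: lb_le_inf; [exists (F 0%N x + 3 / 2 * c 0); exists 0%N|exact: lbS].
  apply: ge_inf; last by exists j.
  by exists (F j x - 3 / 2 * c j) => y; exact: lbS.
by move=> j m x /(Fm _ _ x)/le_trans; apply; have := c_gt0 m; lra.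
Qed.

(** A Banach-Steinhaus theorem for a space [X] that need not be complete: pointwise boundedness is
    asked along uniform limits of sequences in [X]. If uniform boundedness failed, a series of humps
    [psi j] of size [3^-j], each nearly maximal for a functional [L (k j)] of huge norm, would
    converge to some [f] with [|L (k j) f| >= j] for all [j]. *)
Lemma gliding_hump :
    (forall F f, (forall j, X (F j)) -> uniform_limit F f ->
      exists B : R, forall k, `|L k f| <= B) ->
  exists B : R, forall k f, X f -> (forall x, `|f x| <= 1) -> `|L k f| <= B.
Proof.
move=> L_pointwise; apply: contrapT => unbounded.
(* The norm of [L k] on the unit ball exceeds [3 / 2 * |B|], so an element reaching two thirds of
   that norm still has image above [B] and is maximal up to the factor 3/2. *)
have large B : exists p : nat * (T -> R), [/\ X p.2, forall x, `|p.2 x| <= 1,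
    B < `|L p.1 p.2| & forall h, X h -> (forall x, `|h x| <= 1) ->
      `|L p.1 h| <= 3 / 2 * `|L p.1 p.2|].
  have [k [f [Xf f1 Bf]]] : exists k f, [/\ X f, forall x, `|f x| <= 1 &
      3 / 2 * `|B| < `|L k f|].
    apply: contrapT => h; apply: unbounded; exists (3 / 2 * `|B|) => k f Xf f1.
    by rewrite leNgt; apply/negP => Bf; apply: h; exists k, f.
  have [K LK] := L_bounded k.
  pose S := [set `|L k h| | h in [set h | X h /\ forall x, `|h x| <= 1]].
  have supS : has_sup S.
    by split; [exists `|L k f|; exists f|exists K => _ [h [Xh h1] <-]; exact: LK].
  have leS h : X h -> (forall x, `|h x| <= 1) -> `|L k h| <= sup S.
    by move=> Xh h1; apply: sup_upper_bound => //; exists h.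
  have S0 : 3 / 2 * `|B| < sup S by exact: lt_le_trans Bf (leS _ Xf f1).
  have B0 := normr_ge0 B.
  have e0 : 0 < sup S / 3 by lra.
  have [_ [h [Xh h1] <-] hS] := sup_adherent e0 supS.
  exists (k, h); split => //=; first by have := ler_norm B; lra.
  by move=> h' Xh' h'1; have := leS _ Xh' h'1; lra.
(* The factor [3 ^+ j] compensates the size [c j] of the hump, and 4 the loss of three quarters to
   the later humps. *)
have [p hp] := choice (fun j : nat => large (4 * 3 ^+ j * j%:R)).
pose k j := (p j).1; pose psi j := (p j).2.
(* The sign is chosen so that [L (k j)] does not get smaller than the hump. *)
pose step j (f : T -> R) : T -> R := fun x => f x + (if
  c j * `|L (k j) (psi j)| <= `|L (k j) (fun x => f x + c j * psi j x)|
  then c j else - c j) * psi j x.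
pose F := fix F j : T -> R := if j is i.+1 then step i (F i) else fun=> 0.
have XF j : X (F j).
  by elim: j => //= j IH; apply: XD => //; have [] := hp j.
have FS j x : `|F j.+1 x - F j x| <= c j.
  rewrite /= /step addrAC subrr add0r normrM.
  have [_ /(_ x) psi1 _ _] := hp j.
  have -> : `|if c j * `|L (k j) (psi j)| <= `|L (k j) (fun x => F j x + c j * psi j x)|
    then c j else - c j| = c j by case: ifP => _; rewrite ?normrN gtr0_norm.
  by rewrite -[leRHS]mulr1 ler_pM2l.
have LF j : c j * `|L (k j) (psi j)| <= `|L (k j) (F j.+1)|.
  rewrite /= /step; case: ifPn => //; rewrite -ltNge.
  have [Xpsi _ _ _] := hp j.
  have cE y : c j * `|y| = `|c j * y| by rewrite normrM gtr0_norm.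
  rewrite !L_linear// cE mulNr; set a := L _ (F j); set b := c j * _ => ab.
  (* Of [|a + b|] and [|a - b|], at least one is no smaller than [|b|]. *)
  have : `|2 * b| <= `|a + b| + `|a - b|.
    by rewrite (_ : 2 * b = (a + b) - (a - b)) ?ler_normB//; ring.
  by rewrite normrM ger0_norm//; lra.
have [f Ff Fdist] := geometric_uniform_limit FS.
have [B LB] := L_pointwise F f XF Ff.
have far j : j%:R <= B.
  apply: le_trans (LB (k j)).
  have [Xpsi _ Lpsi Lmax] := hp j.
  rewrite -/(k j) -/(psi j) in Lpsi Lmax.
  set l := `|L (k j) (psi j)| in Lpsi Lmax *.
  (* The later humps add up to at most [3 / 2 * c j.+1 = c j / 2] in sup norm; near maximality of
     [psi j] costs another factor 3/2. *)
  have tail m : (j < m)%N -> `|L (k j) (F m) - L (k j) (F j.+1)| <= 3 / 4 * (c j * l).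
    move=> jm; pose d := 3 / 2 * c j.+1.
    have d0 : 0 < d by rewrite mulr_gt0// divr_gt0.
    pose h x := d^-1 * (F m x - F j.+1 x).
    have hE : h = (fun x => 0 + d^-1 * (F m x + -1 * F j.+1 x)).
      by apply/funext => x; rewrite /h add0r mulN1r.
    have L0 : L (k j) (fun=> 0) = 0.
      have := L_linear (k j) (-1) X0 X0.
      by rewrite (_ : (fun _ => _) = fun=> 0) ?mulN1r ?subrr//;
        apply/funext => x; rewrite mulr0 addr0.
    have Xd : X (fun x => F m x + -1 * F j.+1 x) by apply: XD.
    have Xh : X h by rewrite hE; apply: XD.
    have h1 x : `|h x| <= 1.
      rewrite normrM gtr0_norm ?invr_gt0// ler_pdivrMl// mulr1.
      exact: Fdist.
    have := Lmax _ Xh h1; rewrite -/l hE L_linear// L0 add0r L_linear// mulN1r.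
    rewrite normrM gtr0_norm ?invr_gt0// ler_pdivrMl//.
    by rewrite /d cS => /le_trans; apply; lra.
  have lim_tail : `|L (k j) f - L (k j) (F j.+1)| <= 3 / 4 * (c j * l).
    apply/ler_addgt0Pr => e e0.
    have /cvgrPdist_le/(_ e e0)[N _ hN] := L_uniform (k := k j) XF Ff.
    have /= h1 := hN (maxn N j.+1) (leq_maxl _ _).
    rewrite (le_trans (ler_distD (L (k j) (F (maxn N j.+1))) _ _))// addrC lerD//.
    by apply: tail; rewrite leq_maxr.
  have big : 4 * j%:R < c j * l.
    rewrite -(ltr_pM2l (_ : 0 < 3 ^+ j :> R)) ?exprn_gt0//.
    rewrite /c exprVn mulVKf ?expf_neq0//.
    by rewrite mulrCA mulrA.
  have := LF j; rewrite -/l => LFj.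
  have := ler_normD (L (k j) (F j.+1) - L (k j) f) (L (k j) f).
  by rewrite subrK distrC => ?; lra.
have := archi_boundP (normr_ge0 B); rewrite ltNge => /negP; apply.
exact: le_trans (far _) (ler_norm _).
Qed.

End gliding_hump.

(** * Integration of bounded functions against an integrable weight *)

Section weighted_integral.
Context d (T : measurableType d) (R : realType) (mu : {measure set T -> \bar R})
  (S : set T) (mS : measurable S) (w : T -> R)
  (iw : mu.-integrable S (EFin \o w)).

Definition bounded_measurable (f : T -> R) : Prop :=
  measurable_fun S f /\ exists M, forall x, `|f x| <= M.

Lemma bounded_measurable_integrable f :
  bounded_measurable f -> mu.-integrable S (EFin \o (fun x => f x * w x)).
Proof.
move=> [mf [M fM]]; have := integrableMr mS mf _ iw; apply.
exists M; split; first exact: num_real.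
by move=> y My x _ /=; rewrite (le_trans (fM x))// ltW.
Qed.

Let integrable_scale (h : T -> R) c : mu.-integrable S (EFin \o h) ->
  mu.-integrable S (EFin \o (fun x => c * h x)).
Proof.
move=> ih.
by apply: (@eq_integrable _ _ _ _ _ _ (fun x => c%:E * (h x)%:E)%E) => //;
  exact: integrableZl.
Qed.

Lemma bounded_measurable_lin f g c : bounded_measurable f ->
  bounded_measurable g -> bounded_measurable (fun x => f x + c * g x).
Proof.
move=> [mf [M fM]] [mg [N gN]]; split.
  by apply: measurable_funD => //; apply: measurable_funM.
exists (M + `|c| * N) => x; rewrite (le_trans (ler_normD _ _))// lerD//.
by rewrite normrM ler_wpM2l.
Qed.

Lemma weighted_integral_lin f g c : bounded_measurable f ->
  bounded_measurable g ->
  \int[mu]_(x in S) ((f x + c * g x) * w x) =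
  \int[mu]_(x in S) (f x * w x) + c * \int[mu]_(x in S) (g x * w x).
Proof.
move=> bf bg; under eq_Rintegral do rewrite mulrDl -mulrA.
have ig := bounded_measurable_integrable bg.
rewrite RintegralD//; first by rewrite RintegralZl.
  exact: bounded_measurable_integrable.
exact: integrable_scale.
Qed.

Lemma weighted_integral_le f M : bounded_measurable f ->
  (forall x, S x -> `|f x| <= M) ->
  `|\int[mu]_(x in S) (f x * w x)| <= M * \int[mu]_(x in S) `|w x|.
Proof.
move=> bf fM; have ifw := bounded_measurable_integrable bf.
have iaw : mu.-integrable S (EFin \o (fun x => `|w x|)) by exact: integrable_norm.
rewrite (le_trans (le_normr_Rintegral mS ifw))//.
rewrite -RintegralZl//; apply: le_Rintegral => //.
- exact: integrable_norm.
- exact: integrable_scale.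
- by move=> x Sx; rewrite normrM ler_wpM2r// fM.
Qed.

Lemma weighted_integral_uniform F f : (forall j, bounded_measurable (F j)) ->
  uniform_limit F f ->
  \int[mu]_(x in S) (F j x * w x) @[j --> \oo] --> \int[mu]_(x in S) (f x * w x).
Proof.
move=> bF Ff.
have bf : bounded_measurable f.
  split.
    apply: (measurable_fun_cvg (h := F)) => [j|x Sx]; first by have [] := bF j.
    by apply/cvgrPdist_le => e /Ff; apply: filterS => j; exact.
  have [N _ /(_ N (leqnn N)) /= fN] := Ff 1 ltr01.
  have [_ [M FM]] := bF N; exists (1 + M) => x.
  by rewrite -[f x](subrK (F N x)) (le_trans (ler_normD _ _))// lerD.
set I := \int[mu]_(x in S) `|w x|.
have I0 : 0 <= I by exact: Rintegral_ge0.
apply/cvgrPdist_le => e e0.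
(* Adding 1 keeps the divisor positive when the weight has integral 0. *)
have e1 : 0 < e / (I + 1) by rewrite divr_gt0// ltr_wpDl.
apply: filterS (Ff _ e1) => j fj.
have -> : \int[mu]_(x in S) (f x * w x) - \int[mu]_(x in S) (F j x * w x) =
    \int[mu]_(x in S) ((f x + -1 * F j x) * w x).
  by rewrite weighted_integral_lin// mulN1r.
apply: (le_trans (weighted_integral_le (M := e / (I + 1)) _ _)).
- exact: bounded_measurable_lin.
- by move=> x _; rewrite mulN1r.
- by rewrite mulrAC ler_pdivrMr ?ltr_wpDl// ler_wpM2l ?(ltW e0)// lerDl.
Qed.

End weighted_integral.

(** * Continuous functions with compact support *)

Section compactly_supported.
Context (R : realType) (n : nat) (Omega : set 'rV[R]_n.+1).
Implicit Types f g : 'rV[R]_n.+1 -> R.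

Lemma spt0 f x : ~ spt f x -> f x = 0.
Proof.
by move=> sx; apply/eqP; apply: contrapT => /negP fx; apply/sx/subset_closure.
Qed.

Lemma compact_spt_bounded f : continuous f -> compact (spt f) ->
  exists M, forall x, `|f x| <= M.
Proof.
move=> cf csf.
have cimg : compact (f @` spt f).
  by apply: continuous_compact => //; exact: continuous_subspaceT.
have [M [Mreal fM]] := compact_bounded cimg.
exists (`|M| + 1) => x; have [sx|/spt0->] := pselect (spt f x).
  by apply: fM; [rewrite (le_lt_trans (ler_norm _))// ltrDl|exists x].
by rewrite normr0 addr_ge0.
Qed.

Lemma Cc_cst0 : Cc Omega (fun=> 0).
Proof.
have s0 : spt (fun _ : 'rV[R]_n.+1 => 0 : R) = set0.
  rewrite /spt (_ : [set x | _] = set0) ?closure0//.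
  by apply/seteqP; split => x //=; rewrite eqxx.
by split; rewrite ?s0; [exact: cst_continuous|exact: compact0|exact: sub0set].
Qed.

Lemma Cc_lin f g c : Cc Omega f -> Cc Omega g -> Cc Omega (fun x => f x + c * g x).
Proof.
move=> [cf kf sf] [cg kg sg].
have sub : spt (fun x => f x + c * g x) `<=` spt f `|` spt g.
  rewrite -closureU; apply: closure_subset => x /=.
  have [->|f0 _] := eqVneq (f x) 0; last by left.
  by have [->|g0 _] := eqVneq (g x) 0; [rewrite mulr0 addr0 eqxx|right].
split.
- by move=> x; apply: (@cvgD _ R^o _ (nbhs x) _ f (fun x => c * g x));
    [exact: cf|apply: cvgM; [exact: cvg_cst|exact: cg]].
- apply: (subclosed_compact _ _ sub); first exact: closed_closure.
  exact: compactU.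
- by move=> x /sub [/sf|/sg].
Qed.

Lemma Cc_bounded_measurable (mu : {outer_measure set 'rV[R]_n.+1 -> \bar R})
    (S : set (caratheodory_type mu)) f :
    coordinate_halfspaces_measurable mu -> measurable S -> Cc Omega f ->
  bounded_measurable S f.
Proof.
move=> mu_half mS [cf kf _]; split; last exact: compact_spt_bounded.
apply: (@measurable_funS _ _ (caratheodory_type mu) _ setT) => //.
apply: continuous_caratheodory_measurable => //; first exact: openT.
Qed.

End compactly_supported.

(** * Jump parts as functionals on test functions *)

Section jump_measures.
Context (R : realType) (n d : nat) (Omega : set 'rV[R]_n.+1).
Implicit Types u : 'rV[R]_n.+1 -> 'cV[R]_d.

Lemma Ds_lin u i j f g c : SBV Omega u -> Cc Omega f -> Cc Omega g ->
  Ds Omega u (fun x => f x + c * g x) i j =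
  Ds Omega u f i j + c * Ds Omega u g i j.
Proof.
move=> [_ mS iD _] cf cg; rewrite !mxE.
by apply: weighted_integral_lin => //; try exact: iD;
  apply: (Cc_bounded_measurable (@hausdorff_halfspaces R n.+1 n)); eassumption.
Qed.

Lemma Ds_le u i j : SBV Omega u -> exists2 K, 0 <= K &
  forall f M, Cc Omega f -> (forall x, `|f x| <= M) ->
    `|Ds Omega u f i j| <= M * K.
Proof.
move=> [_ mS iD _].
exists (\int[hausdorff n]_(x in jump_set Omega u) `|jump_dyad u x i j|).
  exact: Rintegral_ge0.
move=> f M cf fM; rewrite !mxE.
apply: weighted_integral_le => //; first exact: iD.
by apply: (Cc_bounded_measurable (@hausdorff_halfspaces R n.+1 n)); eassumption.
Qed.

Lemma Ds_uniform u i j F f : SBV Omega u -> (forall k, Cc Omega (F k)) ->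
  uniform_limit F f -> Ds Omega u (F k) i j @[k --> \oo] --> Ds Omega u f i j.
Proof.
move=> [_ mS iD _] cF Ff; rewrite !mxE; under eq_fun do rewrite mxE.
apply: weighted_integral_uniform => //; first exact: iD.
by move=> k; apply: (Cc_bounded_measurable (@hausdorff_halfspaces R n.+1 n)); eauto.
Qed.

(** The gliding hump is applied to each matrix entry on [Cc Omega]. A uniform limit of such
    functions lies in [C0 Omega], where weak-* convergence makes the values a convergent, hence
    bounded, sequence. *)
Lemma weakstar_Ds_bounded (u_ : nat -> 'rV[R]_n.+1 -> 'cV[R]_d) mu :
    (forall k, SBV Omega (u_ k)) ->
    weakstar_cvg Omega (fun k => Ds Omega (u_ k)) mu ->
  exists B, forall k i j f M, Cc Omega f -> 0 < M -> (forall x, `|f x| <= M) ->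
    `|Ds Omega (u_ k) f i j| <= M * B.
Proof.
move=> uSBV umu.
have coord i j : exists B : R, forall k f, Cc Omega f -> (forall x, `|f x| <= 1) ->
    `|Ds Omega (u_ k) f i j| <= B.
  apply: (@gliding_hump _ _ (Cc Omega) (fun k f => Ds Omega (u_ k) f i j)).
  - exact: Cc_cst0.
  - by move=> *; exact: Cc_lin.
  - by move=> *; exact: Ds_lin.
  - move=> k; have [K _ hK] := Ds_le i j (uSBV k); exists K => f cf f1.
    by have := hK f 1 cf f1; rewrite mul1r.
  - by move=> *; exact: Ds_uniform.
  - move=> F f cF Ff.
    have C0f : C0 Omega f.
      move=> e e0; have [N _ /(_ N (leqnn N)) /= fN] := Ff e e0.
      by exists (F N).
    have : Ds Omega (u_ k) f i j @[k --> \oo] --> mu f i j.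
      exact: (@continuous_cvg _ _ _ _ _ _ (fun A : 'M[R]_(d, n.+1) => A i j) _
        (@coord_continuous _ _ _ i j (mu f)) (umu f C0f)).
    move=> /cvgP/cvg_seq_bounded [M [_ hM]].
    exists (`|M| + 1) => k; apply: hM => //.
    by rewrite (le_lt_trans (ler_norm _))// ltrDl.
have /choice[B0 hB0] : forall p : 'I_d * 'I_n.+1, exists B : R, forall k f,
    Cc Omega f -> (forall x, `|f x| <= 1) -> `|Ds Omega (u_ k) f p.1 p.2| <= B.
  by move=> [i j]; exact: coord.
pose B1 i j := B0 (i, j).
(* The sum dominates the bound of every single entry. A test function bounded by [M] is then brought
   into the unit ball by the factor [M^-1]. *)
exists (\sum_i \sum_j `|B1 i j|) => k i j f M cf M0 fM.
rewrite -ler_pdivrMl//.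
have -> : M^-1 * `|Ds Omega (u_ k) f i j| =
    `|Ds Omega (u_ k) (fun x => 0 + M^-1 * f x) i j|.
  have Ds0 : Ds Omega (u_ k) (fun=> 0) i j = 0.
    have [K _ hK] := Ds_le i j (uSBV k).
    apply/eqP; rewrite -normr_eq0 eq_le normr_ge0 andbT.
    by rewrite -[leRHS](mul0r K) hK// => [|y]; [exact: Cc_cst0|rewrite normr0].
  rewrite Ds_lin//; last exact: Cc_cst0.
  by rewrite Ds0 add0r normrM gtr0_norm ?invr_gt0.
apply: (@le_trans _ _ (B1 i j)).
  apply: (hB0 (i, j)); first by apply: Cc_lin => //; exact: Cc_cst0.
  by move=> x; rewrite add0r normrM gtr0_norm ?invr_gt0// ler_pdivrMl// mulr1.
rewrite (le_trans (ler_norm _))// (bigD1 i)//= (bigD1 j)//= -addrA lerDl addr_ge0//.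
  by apply: sumr_ge0.
by apply: sumr_ge0 => *; apply: sumr_ge0.
Qed.

End jump_measures.

(** * Kernels supported in the domain *)

Section euclidean_geometry.
Context (R : realType) (n : nat).
Local Notation V := 'rV[R]_n.
(* [edist] alone would be the extended distance of MathComp-Analysis. *)
Local Notation edist := Defs.edist.
Implicit Types (x y z : V) (B Omega : set V) (r : R).

Lemma enorm_row x : enorm x = Num.sqrt (\sum_i x 0 i ^+ 2).
Proof. by rewrite /enorm big_ord1. Qed.

Lemma enormZ (c : R) x : enorm (c *: x) = `|c| * enorm x.
Proof.
rewrite !enorm_row -sqrtr_sqr -sqrtrM ?sqr_ge0// mulr_sumr.
by congr Num.sqrt; apply: eq_bigr => i _; rewrite !mxE exprMn.
Qed.

Lemma enormN x : enorm (- x) = enorm x.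
Proof. by rewrite -scaleN1r enormZ normrN1 mul1r. Qed.

Lemma enorm_sub_sym x y : enorm (x - y) = enorm (y - x).
Proof. by rewrite -enormN opprB. Qed.

(** Cauchy-Schwarz: the squared length of [x - t *: y] is a nonnegative quadratic in [t], evaluated
    at its minimum [t = P / Y]. *)
Lemma sum_mul_le_enorm x y : \sum_i x 0 i * y 0 i <= enorm x * enorm y.
Proof.
rewrite !enorm_row -sqrtrM; last by apply: sumr_ge0 => *; exact: sqr_ge0.
apply: (le_trans (ler_norm _)); rewrite -sqrtr_sqr ler_wsqrtr//.
set X := \sum_i x 0 i ^+ 2; set Y := \sum_i y 0 i ^+ 2; set P := \sum_i _.
have X0 : 0 <= X by apply: sumr_ge0 => *; exact: sqr_ge0.
have quad t : 0 <= X - t * (2 * P) + t ^+ 2 * Y.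
  have -> : X - t * (2 * P) + t ^+ 2 * Y = \sum_i (x 0 i - t * y 0 i) ^+ 2.
    rewrite 3!mulr_sumr -sumrB -big_split/=; apply: eq_bigr => i _; ring.
  by apply: sumr_ge0 => *; exact: sqr_ge0.
have [Y0|Y0] := eqVneq Y 0.
  have : P = 0.
    apply: big1 => i _; suff -> : y 0 i = 0 by rewrite mulr0.
    have /eqP := Y0; rewrite psumr_eq0; last by move=> *; exact: sqr_ge0.
    by move=> /allP/(_ i (mem_index_enum i)); rewrite sqrf_eq0 => /eqP.
  by move=> ->; rewrite expr0n/= Y0 mulr0.
have Ygt0 : 0 < Y by rewrite lt_def Y0; apply: sumr_ge0 => *; exact: sqr_ge0.
have := quad (P / Y); rewrite -(ler_pM2r Ygt0) mul0r.
rewrite (_ : (_ + _) * Y = X * Y - P ^+ 2) ?subr_ge0//.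
by field.
Qed.

Lemma enormD x y : enorm (x + y) <= enorm x + enorm y.
Proof.
have E0 z : 0 <= \sum_i z 0 i ^+ 2 by apply: sumr_ge0 => *; exact: sqr_ge0.
have sq z : enorm z ^+ 2 = \sum_i z 0 i ^+ 2 by rewrite enorm_row sqr_sqrtr.
rewrite -(@ler_pXn2r _ 2)// ?nnegrE ?addr_ge0 ?enorm_ge0//.
rewrite sqrrD !sq; under eq_bigr do rewrite mxE sqrrD.
rewrite !big_split/= lerD2r lerD2l.
by rewrite mulr2n lerD// sum_mul_le_enorm.
Qed.

Lemma enorm_le_norm x : enorm x <= Num.sqrt n%:R * `|x|.
Proof.
rewrite -[X in _ * X]normr_id -[X in _ * X]sqrtr_sqr -sqrtrM ?ler0n//.
rewrite enorm_row ler_wsqrtr//.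
have -> : n%:R * `|x| ^+ 2 = \sum_(i < n) `|x| ^+ 2.
  by rewrite sumr_const card_ord mulr_natl.
apply: ler_sum => i _; rewrite -real_normK ?num_real//.
by rewrite ler_pXn2r ?nnegrE// coord_le_norm.
Qed.

Lemma edist_le_enorm x y B : B y -> edist x B <= enorm (x - y).
Proof.
move=> By; apply: ge_inf; last by exists y.
by exists 0 => _ [z _ <-]; exact: enorm_ge0.
Qed.

Lemma edist_lipschitz x y B : edist x B <= edist y B + enorm (x - y).
Proof.
(* The infimum of the empty set is 0 by convention, so the distance to an empty [B] is constantly
   0. *)
have [->|/set0P[z0 Bz0]] := eqVneq B set0.
  by rewrite /edist !image_set0 inf0 add0r enorm_ge0.
rewrite -lerBlDr; apply: lb_le_inf; first by exists (enorm (y - z0)), z0.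
move=> _ [z Bz <-]; rewrite lerBlDr (le_trans (edist_le_enorm x Bz))//.
by rewrite (_ : x - z = (y - z) + (x - y)) ?enormD// [RHS]addrC addrA subrK.
Qed.

Lemma edist_continuous B : continuous (fun x => edist x B).
Proof.
move=> x; apply/(@cvgrPdist_le _ R^o _ (nbhs x) (nbhs_filter x)) => e e0.
(* The constant compares the Euclidean length with the sup norm of the topology; adding 1 keeps it
   positive in dimension 0. *)
have C0 : 0 < Num.sqrt n%:R + 1 :> R by rewrite ltr_wpDl// sqrtr_ge0.
near=> y.
have xy : enorm (x - y) <= e.
  apply: (le_trans (enorm_le_norm _)).
  apply: (@le_trans _ _ ((Num.sqrt n%:R + 1) * `|x - y|)).
    by rewrite ler_wpM2r// lerDl.
  rewrite -ler_pdivlMl// mulrC; near: y.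
  by apply: cvgr_dist_le => //; rewrite divr_gt0.
have h1 := edist_lipschitz x y B; have h2 := edist_lipschitz y x B.
rewrite enorm_sub_sym in h2.
by rewrite ler_norml; apply/andP; split; lra.
Unshelve. all: by end_near. Qed.

Lemma inner_set_open Omega r : open Omega -> open (inner_set Omega r).
Proof.
move=> oO; apply: openI => //.
apply: (@open_comp _ _ (fun x => edist x (boundary Omega)) [set t | r < t]).
  by move=> x _; exact: edist_continuous.
exact: open_gt.
Qed.

(** Weakening [r < edist] to [r <= edist] and passing to the closure of [Omega] gives a closed
    bounded set. It stays inside [Omega] because a point of the closure outside [Omega] is a
    boundary point, at distance 0 from the boundary. *)
Lemma inner_compact Omega r : bounded_set Omega -> 0 < r -> exists2 K,
  compact K & inner_set Omega r `<=` K /\ K `<=` Omega.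
Proof.
move=> bO r0.
exists (closure Omega `&` [set x | r <= edist x (boundary Omega)]).
  apply: bounded_closed_compact.
    have [M [Mreal OM]] := bO.
    exists (M + 1); split; first exact: num_real.
    move=> m Mm x [cx _] /=.
    have : closed [set y : V | `|y| <= m].
      apply: (@closed_comp _ _ (fun y : V => `|y|) [set t | t <= m]).
        by move=> y _; exact: norm_continuous.
      exact: closed_le.
    apply; apply: closure_subset cx => y Oy /=; apply: OM => //.
    by rewrite (lt_trans _ Mm)// ltrDl.
  apply: closedI; first exact: closed_closure.
  apply: (@closed_comp _ _ (fun x => edist x (boundary Omega)) [set t | r <= t]).
    by move=> y _; exact: edist_continuous.
  exact: closed_ge.
split=> [x [Ox rx]|x [cx /= rx]]; first by split; [exact: subset_closure|exact: ltW].
apply: interior_subset; apply: contrapT => Ox.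
have := edist_le_enorm x (conj cx Ox : boundary Omega x).
by rewrite subrr -(scale0r 0) enormZ normr0 mul0r => /(le_trans rx); rewrite leNgt r0.
Qed.

(** The segment from [x] to [y] consists of points closer to [x] than the boundary is. Its trace on
    [Omega] is thus open and closed in it, and connectedness puts the whole segment in [Omega]. *)
Lemma eball_inner_set Omega r x : open Omega -> inner_set Omega r x ->
  eball x r `<=` Omega.
Proof.
move=> oO [Ox rx] y xy.
pose f (t : R^o) : V := x + t *: (y - x).
have cf : continuous f.
  by move=> t; apply: cvgD; [exact: cvg_cst|exact: scalel_continuous].
pose A := f @` `[0, 1].
have cA : connected A.
  apply: connected_continuous_connected; first exact: segment_connected.
  exact: continuous_subspaceT.
have Ax : A x by exists 0; rewrite /f/= ?scale0r ?addr0// in_itv/= lexx ler01.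
have Ay : A y.
  by exists 1; rewrite /f/= ?scale1r 1?addrC ?subrK// in_itv/= lexx ler01.
have notbd z : A z -> ~ boundary Omega z.
  move=> [t /=]; rewrite in_itv/= => /andP[t0 t1] <- /(edist_le_enorm x).
  rewrite opprD addrA subrr add0r enormN enormZ ger0_norm//.
  apply/negP; rewrite -ltNge; apply: le_lt_trans rx.
  by apply: ltW; apply: le_lt_trans xy; rewrite ler_piMl// enorm_ge0.
have AO : A `&` Omega = A.
  apply: cA; first by exists x.
    by exists Omega.
  exists (closure Omega); first exact: closed_closure.
  apply/seteqP; split => z [Az Oz]; split => //; first exact: subset_closure.
  apply: interior_subset; apply: contrapT => iz; exact: (notbd z Az).
by have [] : (A `&` Omega) y by rewrite AO.
Qed.

End euclidean_geometry.

(** * Dilations, reflections and translations of test functions *)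

Section kernels.
Context (R : realType) (n : nat).
Local Notation V := 'rV[R]_n.+1.
Implicit Types (a f g : V -> R) (x y z : V) (r : R).

Lemma compact_spt_image f g (h : V -> V) : continuous h -> compact (spt g) ->
    (forall x, f x != 0 -> exists2 y, g y != 0 & h y = x) ->
  spt f `<=` h @` spt g /\ compact (spt f).
Proof.
move=> ch kg fg.
have kh : compact (h @` spt g).
  by apply: continuous_compact => //; exact: continuous_subspaceT.
have sub : spt f `<=` h @` spt g.
  rewrite [X in _ `<=` X](closure_id _).1; last first.
    by apply: compact_closed => //; exact: norm_hausdorff.
  apply: closure_subset => x /= /fg [y gy <-]; exists y => //.
  exact: subset_closure.
by split => //; apply: subclosed_compact sub => //; exact: closed_closure.
Qed.

Lemma rescale_Cc f r : 0 < r -> Cc (eball 0 1) f -> Cc (eball 0 r) (rescale f r).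
Proof.
move=> r0 [cf kf sf]; have rn0 : r != 0 by rewrite gt_eqF.
have [sub kr] : spt (rescale f r) `<=` *:%R r @` spt f /\ compact (spt (rescale f r)).
  apply: compact_spt_image => //; first exact: scaler_continuous.
  move=> x; rewrite /rescale mulf_eq0 negb_or => /andP[_ fx].
  by exists (r^-1 *: x) => //; rewrite scalerA divff// scale1r.
split => //.
  move=> x; apply: (@continuousM _ _ (fun=> r ^- n.+1) (fun x => f (r^-1 *: x))).
    exact: cst_continuous.
  have scale_cvg : r^-1 *: y @[y --> x] --> r^-1 *: x by exact: scaler_continuous.
  exact: (cvg_comp _ _ scale_cvg (cf _)).
move=> t /sub [x /sf]; rewrite /eball/= !subr0 => x1 <-.
by rewrite enormZ gtr0_norm// -[ltRHS]mulr1 ltr_pM2l.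
Qed.

Lemma reflect_continuous x : continuous (fun y => x - y).
Proof. by move=> y; apply: (@cvgB _ V _ (nbhs y)); [exact: cvg_cst|exact: cvg_id]. Qed.

Lemma reflect_Cc a r x : Cc (eball 0 r) a -> Cc (eball x r) (fun y => a (x - y)).
Proof.
move=> [ca ka sa].
have [sub kr] : spt (fun y => a (x - y)) `<=` (fun z => x - z) @` spt a /\
    compact (spt (fun y => a (x - y))).
  apply: compact_spt_image => //; first exact: reflect_continuous.
  by move=> y ay; exists (x - y) => //; rewrite opprB addrC subrK.
split => //.
  move=> y.
  exact: (cvg_comp _ _ (@reflect_continuous x y) (ca _)).
move=> t /sub [z /sa]; rewrite /eball/= subr0 => zr <-.
by rewrite addrAC subrr add0r enormN.
Qed.

Lemma Cc_subset f (A B : set V) : A `<=` B -> Cc A f -> Cc B f.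
Proof. by move=> AB [cf kf sf]; split => //; exact: subset_trans AB. Qed.

Lemma Cc_C0 (A : set V) f : Cc A f -> C0 A f.
Proof. by move=> Cf e e0; exists f => // x _; rewrite subrr normr0 ltW. Qed.

(** Uniform continuity of [a]: a near-covering argument handles the [y] in a compact ball around
    [x], and outside that ball both values vanish. *)
Lemma Cc_translation_uniform (A : set V) a x e : 0 < e -> Cc A a ->
  \forall x' \near x, forall y, `|a (x - y) - a (x' - y)| <= e.
Proof.
move=> e0 [ca ka _].
have [M [_ aM]] := compact_bounded ka.
pose m := `|M| + 1.
have a0 z : m < `|z| -> a z = 0.
  move=> mz; apply: spt0 => /aM; have Mm : M < m.
    by rewrite (le_lt_trans (ler_norm _))// ltrDl.
  by move=> /(_ m Mm)/=; rewrite leNgt mz.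
(* The extra unit absorbs the displacement [|x - x'| < 1], so that [x' - y] also leaves the support
   of [a] when [y] is outside [K]. *)
pose K := [set y : V | `|x - y| <= m + 1].
have kK : compact K.
  apply: bounded_closed_compact.
    exists (`|x| + (m + 1)); split; first exact: num_real.
    move=> N hN y /= xy; apply: ltW; apply: le_lt_trans hN.
    rewrite -[y](subrK x) (le_trans (ler_normD _ _))// addrC lerD//.
    by rewrite distrC.
  apply: (@closed_comp _ _ (fun y : V => `|x - y|) [set t | t <= m + 1]).
    move=> y _.
    exact: (cvg_comp _ _ (@reflect_continuous x y) (@norm_continuous _ _ (x - y))).
  exact: closed_le.
have nearK : \forall x' \near x, K `<=` [set y | `|a (x - y) - a (x' - y)| <= e].
  apply: (((compact_near_coveringP K).1 kK) V (nbhs x)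
    (fun x' y => `|a (x - y) - a (x' - y)| <= e) _) => y _.
  have e2 : 0 < e / 2 by rewrite divr_gt0.
  have ca_at : \forall z \near (x - y), `|a (x - y) - a z| <= e / 2.
    have /(@cvgrPdist_le _ R^o _ (nbhs (x - y)) (nbhs_filter _))/(_ _ e2) := ca (x - y).
    exact.
  have h1 : \forall p \near (y, x), `|a (x - y) - a (x - p.1)| <= e / 2.
    have : (fun p : V * V => x - p.1) @ (y, x) --> x - y.
      by apply: (@cvgB _ V _ (nbhs (y, x))); [exact: cvg_cst|exact: cvg_fst].
    by move/(_ _ ca_at).
  have h2 : \forall p \near (y, x), `|a (x - y) - a (p.2 - p.1)| <= e / 2.
    have : (fun p : V * V => p.2 - p.1) @ (y, x) --> x - y.
      by apply: (@cvgB _ V _ (nbhs (y, x))); [exact: cvg_snd|exact: cvg_fst].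
    by move/(_ _ ca_at).
  apply: filterS2 h1 h2 => -[y' x'] /= h1 h2.
  rewrite (le_trans (ler_distD (a (x - y)) _ _))// distrC (splitr e) lerD//.
have near1 : \forall x' \near x, `|x - x'| < 1.
  apply/nbhs_ballP; exists 1 => //= x'.
  by rewrite -ball_normE.
apply: filterS2 nearK near1 => x' xK xx' y.
have [Ky|Ky] := pselect (K y); first exact: xK.
have {}Ky : m + 1 < `|x - y| by rewrite ltNge; apply/negP.
rewrite !a0 ?subrr ?normr0 ?ltW//; last by rewrite (lt_trans _ Ky)// ltrDl.
rewrite -(ltrD2r 1) (lt_le_trans Ky)//.
by rewrite (le_trans (ler_distD x' _ _))// addrC lerD// ltW.
Qed.

End kernels.

(** * Averages as measures tested against kernels *)

Section averages.
Context (R : realType) (n d : nat).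
Local Notation V := 'rV[R]_n.+1.
Variables (alpha : V -> R) (r : R) (Omega : set V).
Hypotheses (r_gt0 : 0 < r) (alpha_Cc : Cc (eball 0 1) alpha)
  (Omega_open : open Omega).

Definition kernel (x : V) : V -> R := fun y => rescale alpha r (x - y).

Lemma kernel_Cc x : inner_set Omega r x -> Cc Omega (kernel x).
Proof.
move=> Ox; apply: (Cc_subset (eball_inner_set Omega_open Ox)).
by apply: reflect_Cc; exact: rescale_Cc.
Qed.

Lemma kernel0 x y : ~ eball x r y -> kernel x y = 0.
Proof.
move=> xy; apply: (@spt0 _ _ (kernel x)) => sy; apply: xy.
have [_ _] : Cc (eball x r) (kernel x) by apply: reflect_Cc; exact: rescale_Cc.
exact.
Qed.

(** The restriction to the ball changes nothing, since the kernel vanishes outside it. *)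
Lemma jump_average_Ds (u : V -> 'cV[R]_d) x :
  jump_average alpha r Omega u x = Ds Omega u (kernel x).
Proof.
apply/matrixP => i j; rewrite !mxE Rintegral_mkcond [RHS]Rintegral_mkcond.
apply: eq_Rintegral => y _; rewrite !patchE in_setI.
have [yb|yb] := boolP (y \in eball x r); first by rewrite andTb.
rewrite andFb; case: ifP => // _.
by rewrite kernel0 ?mul0r//; rewrite notin_setE in yb.
Qed.

Lemma bulk_average_lebesgue (F : V -> 'M[R]_(d, n.+1)) x :
  inner_set Omega r x -> bulk_average alpha r F x = lebesgue_part Omega F (kernel x).
Proof.
move=> Ox; have sub := eball_inner_set Omega_open Ox.
apply/matrixP => i j; rewrite !mxE Rintegral_mkcond [RHS]Rintegral_mkcond.
apply: eq_Rintegral => y _; rewrite !patchE.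
have [yb|yb] := boolP (y \in eball x r).
  by rewrite mem_set//; apply: sub; exact: set_mem.
case: ifP => // _.
by rewrite kernel0 ?mul0r//; rewrite notin_setE in yb.
Qed.

(** Nearby points have uniformly close kernels, on which the jump measure is bounded. Continuity is
    what makes the energy densities measurable. *)
Lemma jump_average_continuous (u : V -> 'cV[R]_d) : SBV Omega u ->
  {in inner_set Omega r, continuous (jump_average alpha r Omega u)}.
Proof.
move=> uSBV x /set_mem Ox.
have [B hB] : exists B, forall i j f M, Cc Omega f -> 0 < M ->
    (forall x, `|f x| <= M) -> `|Ds Omega u f i j| <= M * B.
  (* Uniform boundedness along the constant sequence [u] gives one constant for all entries. *)
  have [B hB] := weakstar_Ds_bounded (fun=> uSBV) (fun _ _ => @cvg_cst _ _ _ _ _).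
  by exists B; exact: hB.
apply/(@cvg_ballP _ _ _ (nbhs x) (nbhs_filter x)) => e e0.
pose M := e / 2 / (`|B| + 1).
have B1 : 0 < `|B| + 1 by rewrite ltr_wpDl.
have M0 : 0 < M by rewrite !divr_gt0.
have near_inner : \forall x' \near x, inner_set Omega r x'.
  by apply: open_nbhs_nbhs; split => //; exact: inner_set_open.
have near_kernel := Cc_translation_uniform x M0 (rescale_Cc r_gt0 alpha_Cc).
apply: filterS2 near_inner near_kernel => x' Ox' xx'.
split=> // i j; rewrite !jump_average_Ds -ball_normE/=.
have -> : Ds Omega u (kernel x) i j - Ds Omega u (kernel x') i j =
    Ds Omega u (fun y => kernel x y + -1 * kernel x' y) i j.
  by rewrite Ds_lin ?mulN1r//; exact: kernel_Cc.
apply: (@le_lt_trans _ _ (M * B)).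
  apply: hB => //; first by apply: Cc_lin; exact: kernel_Cc.
  by move=> y; rewrite mulN1r; exact: xx'.
apply: (@le_lt_trans _ _ (e / 2)); last by rewrite ltr_pdivrMr// ltr_pMr// ltr1n.
rewrite /M mulrAC ler_pdivrMr// ler_wpM2l ?divr_ge0 ?(ltW e0)//.
by rewrite (le_trans (ler_norm B))// lerDl.
Qed.

End averages.

(** The set is the image under the continuous map [vec_mx] of a cube of row vectors, which is
    compact as a product of segments. *)
Lemma entrywise_bounded_compact (R : realType) m k (b : R) :
  compact [set A : 'M[R]_(m, k) | forall i j, `|A i j| <= b].
Proof.
have kQ : compact [set v : 'rV[R]_(m * k) | forall i, `[- b, b]%classic (v ord0 i)].
  by apply: (@rV_compact _ _ (fun=> `[- b, b]%classic)) => i; exact: segment_compact.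
have cv : continuous (@vec_mx R m k).
  move=> v; apply/(@cvg_ballP _ _ _ (nbhs v) (nbhs_filter v)) => e e0.
  apply/nbhs_ballP; exists e => //= w [_ vw]; split=> // i j.
  by rewrite !mxE; exact: vw.
have := continuous_compact (continuous_subspaceT cv) kQ.
congr compact; apply/seteqP; split => [_ [v vb <-] i j|A Ab].
  by have := vb (mxvec_index i j); rewrite mxE /= in_itv/= -ler_norml.
exists (mxvec A); last exact: mxvecK.
move=> i; case/mxvec_indexP: i => i j.
by rewrite mxvecE /= in_itv/= -ler_norml.
Qed.

(** * Boundedness and continuity of the energy density *)

Section Psi.
Context (R : realType) (n d : nat) (Omega : set 'rV[R]_n.+1)
  (Psi : 'rV[R]_n.+1 -> 'M[R]_(d, n.+1) -> R).
Hypothesis Psi_continuous : {within Omega `*` [set: 'M[R]_(d, n.+1)],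
    continuous (fun p : 'rV[R]_n.+1 * 'M[R]_(d, n.+1) => Psi p.1 p.2)}.

Lemma density_bounded (K : set 'rV[R]_n.+1) (b : R) : compact K -> K `<=` Omega ->
  exists C : R, forall x (A : 'M[R]_(d, n.+1)), K x ->
    (forall i j, `|A i j| <= b) -> `|Psi x A| <= C.
Proof.
move=> kK KO.
pose Q := [set A : 'M[R]_(d, n.+1) | forall i j, `|A i j| <= b].
have kKQ : compact (K `*` Q).
  by apply: compact_setX => //; exact: entrywise_bounded_compact.
have cKQ : {within K `*` Q,
    continuous (fun p : 'rV[R]_n.+1 * 'M[R]_(d, n.+1) => Psi p.1 p.2)}.
  by apply: continuous_subspaceW Psi_continuous => -[x A] [/= /KO].
have [M [_ hM]] := compact_bounded (continuous_compact cKQ kKQ).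
exists (`|M| + 1) => x A Kx Ab; apply: (hM (`|M| + 1)).
  by rewrite (le_lt_trans (ler_norm _))// ltrDl.
by exists (x, A).
Qed.

(** Since [Omega] is open, continuity within the product is plain continuity at its points. The
    filter is left general to serve both the limit in [n] at fixed [x] and continuity in [x] at
    fixed [n]. *)
Lemma density_cvg (T : Type) (F : set_system T) (FF : Filter F)
    (f : T -> 'rV[R]_n.+1) (h : T -> 'M[R]_(d, n.+1)) x A : open Omega ->
    Omega x -> f @ F --> x -> h @ F --> A ->
  Psi (f t) (h t) @[t --> F] --> Psi x A.
Proof.
move=> oO Ox fx hA.
have oOM : open (Omega `*` [set: 'M[R]_(d, n.+1)]).
  rewrite openE => -[y A'] [/= Oy _]; exists (Omega, setT) => //.
  by split; [exact: open_nbhs_nbhs|exact: filterT].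
have := Psi_continuous; rewrite continuous_open_subspace// => c.
have xA : (x, A) \in Omega `*` [set: 'M[R]_(d, n.+1)] by rewrite inE.
exact: (cvg_comp _ _ (cvg_pair fx hA) (c (x, A) xA)).
Qed.

End Psi.

(** * Passage to the limit in the energy *)

Theorem theorem3p1 (R : realType) (n d : nat)
  (Omega : set 'rV[R]_n.+1)
  (Omega_bounded : bounded_set Omega) (Omega_connected : connected Omega)
  (Omega_open : open Omega) (Omega_lipschitz : lipschitz_boundary Omega)
  (Psi : 'rV[R]_n.+1 -> 'M[R]_(d, n.+1) -> R)
  (Psi_ge0 : forall x A, Omega x -> 0 <= Psi x A)
  (Psi_continuous : {within Omega `*` [set: 'M[R]_(d, n.+1)],
    continuous (fun p : 'rV[R]_n.+1 * 'M[R]_(d, n.+1) => Psi p.1 p.2)})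
  (r : R) (r_gt0 : 0 < r)
  (alpha : 'rV[R]_n.+1 -> R) (alpha_smooth : Csmooth alpha)
  (alpha_compact : compact (spt alpha)) (alpha_spt : spt alpha `<=` eball 0 1)
  (alpha_int1 : (\int[leb]_(x in eball (0%R : 'rV[R]_n.+1) 1) alpha x)%R = 1)
  (g : 'rV[R]_n.+1 -> 'cV[R]_d) (G : 'rV[R]_n.+1 -> 'M[R]_(d, n.+1))
  (g_SBV : SBV Omega g) (G_L1 : L1mx Omega G)
  (u_ : nat -> 'rV[R]_n.+1 -> 'cV[R]_d) (u_Ad : Ad Omega g G u_) :
  energy Psi alpha r Omega (u_ k) @[k --> \oo] -->
  (\int[leb]_(x in inner_set Omega r)
    (Psi x (bulk_average alpha r (fun y => nabla Omega g y - G y)%R x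
            + jump_average alpha r Omega g x)%R)%:E)%E.
Proof.
have [uSBV _ _ Ds_cvg] := u_Ad.
have alpha_Cc : Cc (eball 0 1) alpha by split => //; exact: (alpha_smooth 0).
have [K kK [DK KO]] := inner_compact Omega_bounded r_gt0.
have kernelC x := @kernel_Cc R n alpha r Omega r_gt0 alpha_Cc Omega_open x.
set D := inner_set Omega r.
have oD : open D by exact: inner_set_open.
have mD : measurable (D : set (caratheodory_type (@leb_outer R n))).
  by apply: (@open_caratheodory _ _ (@leb_outer R n)) => //; exact: leb_halfspaces.
have [B hB] := weakstar_Ds_bounded uSBV Ds_cvg.
have [M [M0 aM]] : exists M, 0 < M /\ forall x y, `|kernel alpha r x y| <= M.
  have [ca ka _] := rescale_Cc r_gt0 alpha_Cc.
  have [M aM] := compact_spt_bounded ca ka.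
  exists (`|M| + 1); split; first by rewrite ltr_wpDl.
  by move=> x y; rewrite (le_trans (aM _))// (le_trans (ler_norm _))// lerDl.
(* Every entry of every inner integral is at most [M * B] in absolute value, uniformly in [x] and
   [k], so [C] bounds all the integrands. *)
have [C hC] := density_bounded Psi_continuous (M * B) kK KO.
pose f_ k x := (Psi x (jump_average alpha r Omega (u_ k) x))%:E.
have f_cvg x : D x -> f_ ^~ x @ \oo -->
    (Psi x (bulk_average alpha r (fun y => nabla Omega g y - G y)%R x
            + jump_average alpha r Omega g x)%R)%:E.
  move=> Dx; apply: cvg_EFin; first by apply: nearW => k.
  have Ox : Omega x by apply/KO/DK.
  apply: (@density_cvg R n d Omega Psi Psi_continuous nat \oo _ (fun=> x)
    (fun k => jump_average alpha r Omega (u_ k) x) x _ Omega_open Ox (cvg_cst _)).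
  rewrite jump_average_Ds// (bulk_average_lebesgue _ alpha_Cc Omega_open)//.
  under eq_fun do rewrite jump_average_Ds//.
  exact: Ds_cvg (Cc_C0 (kernelC _ Dx)).
have mf_ k : measurable_fun (D : set (caratheodory_type (@leb_outer R n))) (f_ k).
  apply/measurable_EFinP.
  apply: continuous_caratheodory_measurable => //; first exact: leb_halfspaces.
  move=> x /[dup] Dx /set_mem/DK/KO Ox.
  apply: (@density_cvg R n d Omega Psi Psi_continuous _ (nbhs x) _ id
    (jump_average alpha r Omega (u_ k)) x _ Omega_open Ox cvg_id).
  exact: (@jump_average_continuous R n d alpha r Omega r_gt0 alpha_Cc Omega_open
    _ (uSBV k) x Dx).
(* The constant [C] is integrable on [D] because [D] is contained in the bounded set [Omega]. *)
apply: (dominated_cvg mD mf_ (g := EFin \o cst C)) => //.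
- apply/integrableP; split; first exact/measurable_EFinP.
  have -> : (fun x => `|(EFin \o cst C) x|%E) = cst `|C|%:E by [].
  rewrite integral_cst// lte_mul_pinfty//.
  apply: leb_bounded_lty; have [N [Nreal ON]] := Omega_bounded.
  by exists N; split => // N' NN' x /DK/KO; exact: ON.
- move=> k x Dx; rewrite /= lee_fin hC//; first exact: DK.
  move=> i j; rewrite jump_average_Ds//; apply: hB => //; exact: kernelC.
Qed.
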